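(* Let $S\subset\mathbb{R}^n$ be a closed semialgebraic set and let $S=\bigsqcup_{\alpha\in A}M_\alpha$ be a finite $C^2$ semialgebraic stratification. Let $\bar x\in S$ and $u\in T_S(\bar x)$. Then: (i) The set $A(\bar x,u)$ is finite and nonempty. (ii) $T^2_S(\bar x;u)\subseteq\bigcup_{\alpha\in A(\bar x,u)}T^2_{\operatorname{cl}M_\alpha}(\bar x;u)$. (iii) For every $\alpha\in A(\bar x,u)$, $T^{2,\mathrm{arc}}_{\alpha}S(\bar x;u)\subseteq T^2_S(\bar x;u)$. (iv) If every selected stratum is branchwise parabolically arc-regular at $(\bar x,u)$, namely $T^2_{\operatorname{cl}M_\alpha}(\bar x;u)=T^{2,\mathrm{arc}}_{\alpha}S(\bar x;u)$ for all $\alpha\in A(\bar x,u)$, then $$T^2_S(\bar x;u)=\bigcup_{\alpha\in A(\bar x,u)}T^2_{\operatorname{cl}M_\alpha}(\bar x;u).$$ (v) In particular, if $u$ selects a unique stratum, $A(\bar x,u)=\{\alpha_0\}$, and $T^2_{\operatorname{cl}M_{\alpha_0}}(\bar x;u)=T^{2,\mathrm{arc}}_{\alpha_0}S(\bar x;u)$, then $T^2_S(\bar x;u)=T^2_{\operatorname{cl}M_{\alpha_0}}(\bar x;u)$.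
   Context: For a set $X\subset\mathbb{R}^n$ and $\bar x\in X$, the Bouligand tangent cone is $T_X(\bar x)=\{u\in\mathbb{R}^n:\exists t_k\downarrow 0,\ \exists u_k\to u \text{ with } \bar x+t_ku_k\in X\text{ for all }k\}$ ($t_k\downarrow0$ means $t_k>0$, $t_k\to0$), and for $u\in T_X(\bar x)$ the (outer) parabolic second-order tangent set $T^2_X(\bar x;u)$ is the set of all $w\in\mathbb{R}^n$ such that there exist $t_k\downarrow0$ and $w_k\to w$ with $\bar x+t_ku+\tfrac12t_k^2w_k\in X$ for all $k$. A finite $C^2$ semialgebraic stratification is taken in the standard sense: in particular $A$ is finite and the $M_\alpha$ are pairwise disjoint semialgebraic $C^2$ submanifolds of $\mathbb{R}^n$ with union $S$. $\operatorname{cl}$ denotes closure. Strata selected by $u$: $A(\bar x,u)=\{\alpha\in A:\bar x\in\operatorname{cl}M_\alpha\text{ and }u\in T_{\operatorname{cl}M_\alpha}(\bar x)\}$. For $\alpha\in A(\bar x,u)$, $T^{2,\mathrm{arc}}_{\alpha}S(\bar x;u)$ is the set of all $w\in\mathbb{R}^n$ for which there exist $\varepsilon>0$ and a semialgebraic arc $\gamma:(0,\varepsilon)\to M_\alpha$ with $\gamma(t)=\bar x+tu+\tfrac12t^2w+o(t^2)$ as $t\downarrow0$. *)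

(* Defs.v *)
From HB Require Import structures.
From mathcomp Require Import all_boot all_order all_algebra.
From mathcomp Require Import all_classical all_reals all_analysis.
(* The notations of mpoly would clash with those of mathcomp-analysis. *)
From mathcomp Require Import -(notations) mpoly.

Set Implicit Arguments.
Unset Strict Implicit.
Unset Printing Implicit Defensive.

Import Order.TTheory GRing.Theory Num.Theory.
Import numFieldNormedType.Exports.

Local Open Scope classical_set_scope.
Local Open Scope ring_scope.

(* A finite union of sets {x | p_i(x) = 0 for all i, q_j(x) > 0 for all j}; each
   pair c lists the equations c.1 = (p_i)_i and the strict inequalities
   c.2 = (q_j)_j of one set of the union. *)
Definition semialgebraic (R : realType) (n : nat) (X : set 'rV[R]_n) : Prop :=
  exists cs : seq (seq (mpoly n R) * seq (mpoly n R)),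
    X = [set x | exists2 c, c \in cs &
      (forall p, p \in c.1 -> meval (x ord0) p = 0) /\
      (forall q, q \in c.2 -> 0 < meval (x ord0) q)].

(* Since R^n has finite dimension, the continuity of all iterated directional
   derivatives amounts to that of the iterated Frechet derivatives. *)
Fixpoint Ck_on (R : realType) (V W : normedModType R) (k : nat)
    (U : set V) (f : V -> W) : Prop :=
  if k is j.+1 then
    {in U, forall x, differentiable f x} /\ forall v : V, Ck_on j U ('D_v f)
  else {in U, continuous f}.

(* The coordinate subspace R^d x {0} of R^n. *)
Definition coord_subspace (R : realType) (n d : nat) : set 'rV[R]_n :=
  [set y | forall i : 'I_n, (d <= i)%N -> y ord0 i = 0].

(* Phi is a C^k diffeomorphism from the open set U onto the open set V, with
   inverse Psi; the values of Phi off U and of Psi off V are irrelevant. *)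
Definition Ck_diffeo (R : realType) (n k : nat) (U V : set 'rV[R]_n)
    (Phi Psi : 'rV[R]_n -> 'rV[R]_n) : Prop :=
  [/\ open U /\ open V,
      Phi @` U = V,
      {in U, cancel Phi Psi},
      Ck_on k U Phi &
      Ck_on k V Psi].

Definition Ck_submanifold (R : realType) (n k : nat) (M : set 'rV[R]_n) : Prop :=
  exists2 d : nat, (d <= n)%N &
    forall x, M x -> exists U V Phi Psi,
      [/\ U x, Ck_diffeo k U V Phi Psi &
          Phi @` (M `&` U) = @coord_subspace R n d `&` V].

(* The last clause is the frontier condition. *)
Definition finite_C2_semialgebraic_stratification (R : realType) (n : nat)
    (A : Type) (S : set 'rV[R]_n) (M : A -> set 'rV[R]_n) : Prop :=
  [/\ finite_set [set: A],
      forall a, semialgebraic (M a) /\ Ck_submanifold 2 (M a),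
      trivIset [set: A] M,
      \bigcup_a M a = S &
      forall a b, M a `&` closure (M b) !=set0 -> M a `<=` closure (M b)].

Definition decreases_to0 (R : realType) (t : R^nat) : Prop :=
  (forall k, 0 < t k) /\ t @ \oo --> (0 : R).

Definition tangent_cone (R : realType) (n : nat) (X : set 'rV[R]_n)
    (x : 'rV[R]_n) : set 'rV[R]_n :=
  [set u | exists (t : R^nat) (v : nat -> 'rV[R]_n),
    [/\ decreases_to0 t, v @ \oo --> u & forall k, X (x + t k *: v k)]].

Definition second_order_tangent_set (R : realType) (n : nat) (X : set 'rV[R]_n)
    (x u : 'rV[R]_n) : set 'rV[R]_n :=
  [set w | exists (t : R^nat) (v : nat -> 'rV[R]_n),
    [/\ decreases_to0 t, v @ \oo --> w &
        forall k, X (x + t k *: u + (2^-1 * t k ^+ 2) *: v k)]].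

Definition selected_strata (R : realType) (n : nat) (A : Type)
    (M : A -> set 'rV[R]_n) (x u : 'rV[R]_n) : set A :=
  [set a | closure (M a) x /\ tangent_cone (closure (M a)) x u].

(* The graph of gamma over ]0, e[ is viewed as a subset of R^(1 + n); the values
   of gamma off ]0, e[ are irrelevant. *)
Definition semialgebraic_arc (R : realType) (n : nat) (M : set 'rV[R]_n) (e : R)
    (gamma : R -> 'rV[R]_n) : Prop :=
  [/\ {in `]0, e[, continuous gamma},
      {in `]0, e[, forall t, M (gamma t)} &
      semialgebraic [set row_mx (t%:M : 'rV[R]_1) (gamma t) | t in `]0, e[]].

Definition arc_second_order_tangent_set (R : realType) (n : nat)
    (M : set 'rV[R]_n) (x u : 'rV[R]_n) : set 'rV[R]_n :=
  [set w | exists (e : R) (gamma : R -> 'rV[R]_n),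
    [/\ 0 < e, semialgebraic_arc M e gamma &
        (fun t => gamma t - (x + t *: u + (2^-1 * t ^+ 2) *: w))
          =o_ ((0 : R)^'+) (fun t => t ^+ 2 : R^o)]].

(* Main.v *)
Require Import Defs.
From HB Require Import structures.
From mathcomp Require Import all_boot all_order all_algebra.
From mathcomp Require Import all_classical all_reals all_analysis.

(** Whether a vector is tangent, to first or to second order, is witnessed by
    one sequence of points of the set, and such a witness survives passage to a
    subsequence.  If the set is a finite union of strata, one stratum contains
    infinitely many points of the witnessing sequence, so the vector is already
    tangent to that stratum ([tangent_cone_bigcup],
    [second_order_tangent_set_bigcup]).  Applied to [u] this shows that some
    stratum is selected.  Applied to [w] in [T2 S] it yields a stratum with [w]
    in its second-order tangent set; that stratum is selected by [u] because a
    parabolic expansion [x + t u + t^2 w / 2] is also a first-order one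
    ([second_order_tangent_set_tangent]).

    Conversely, an arc with the expansion [x + t u + t^2 w / 2 + o(t^2)] can be
    sampled along a sequence of times decreasing to 0, which makes [w] a
    second-order tangent vector of the stratum
    ([arc_second_order_tangent_set_sub]).  As [S] is closed, it contains the
    closures of all strata, so their second-order tangent sets lie in that of
    [S].  The equalities are the combination of the two inclusions. *)

Set Implicit Arguments.
Unset Strict Implicit.
Unset Printing Implicit Defensive.

Import Order.TTheory GRing.Theory Num.Theory.
Import numFieldNormedType.Exports.

Local Open Scope classical_set_scope.
Local Open Scope ring_scope.

(** By the pigeonhole principle one of the sets contains infinitely many terms,
    and an infinite set of indices can be enumerated increasingly. *)
Lemma bigcup_finite_subsequence (T A : Type) (M : A -> set T) (p : nat -> T) :
  finite_set [set: A] -> (forall k, (\bigcup_a M a) (p k)) ->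
  exists (a : A) (f : nat -> nat),
    f @ \oo --> \oo /\ forall k, M a (p (f k)).
Proof.
move=> finA /= Mp.
have /choice[b bP] : forall k, exists a, M a (p k).
  by move=> k; have [a _ Ma] := Mp k; exists a.
have finb : finite_set (range b) by apply: sub_finite_set finA.
have [a [B Binf Bb]] := finite_range_cst_subsequence finb.
have /= [|f [fincr _ fB]] := infinite_increasing_seq_wf _ Binf 0.
  by move=> m; apply: sub_finite_set (finite_II m.+1) => j /=.
exists a, f; split; last by move=> k; rewrite -((Bb (f k)).1 (fB k)).
apply/cvgnyPge => m; near=> k.
have le_f j : (j <= f j)%N.
  elim: j => // j IHj; apply: leq_ltn_trans IHj _.
  by have /increasing_seqP := fincr; apply.
by apply: leq_trans (le_f k); near: k; exact: nbhs_infty_ge.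
Unshelve. all: by end_near. Qed.

Lemma decreases_to0_subsequence (R : realType) (t : R^nat) (f : nat -> nat) :
  f @ \oo --> \oo -> decreases_to0 t -> decreases_to0 (t \o f).
Proof.
move=> foo [t0 tcvg]; split=> [k|]; first exact: t0.
by apply: cvg_comp foo tcvg.
Qed.

Lemma decreases_to0_scaled_harmonic (R : realType) (c : R) :
  0 < c -> decreases_to0 (fun k => c * harmonic k).
Proof.
move=> c0; split=> [k|]; first by rewrite mulr_gt0 // harmonic_gt0.
by rewrite -[X in _ --> X](mulr0 c); apply: cvgMr; exact: cvg_harmonic.
Qed.

Section tangent_sets.
Variables (R : realType) (n : nat).
Implicit Types (X Y : set 'rV[R]_n) (x u w : 'rV[R]_n).

Lemma tangent_cone_sub X Y x : X `<=` Y -> tangent_cone X x `<=` tangent_cone Y x.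
Proof.
by move=> XY u [t [v [t0 vu Xv]]]; exists t, v; split=> // k; exact/XY.
Qed.

Lemma second_order_tangent_set_sub X Y x u : X `<=` Y ->
  second_order_tangent_set X x u `<=` second_order_tangent_set Y x u.
Proof.
by move=> XY w [t [v [t0 vw Xv]]]; exists t, v; split=> // k; exact/XY.
Qed.

Lemma tangent_cone_bigcup (A : Type) (M : A -> set 'rV[R]_n) x :
  finite_set [set: A] ->
  tangent_cone (\bigcup_a M a) x `<=` \bigcup_a tangent_cone (M a) x.
Proof.
move=> finA u [t [v [t0 vu Mv]]].
have [a [f [foo Ma]]] := bigcup_finite_subsequence finA Mv.
exists a => //; exists (t \o f), (v \o f); split=> //.
  exact: decreases_to0_subsequence.
by apply: cvg_comp foo vu.
Qed.

Lemma second_order_tangent_set_bigcup (A : Type) (M : A -> set 'rV[R]_n) x u :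
  finite_set [set: A] ->
  second_order_tangent_set (\bigcup_a M a) x u
    `<=` \bigcup_a second_order_tangent_set (M a) x u.
Proof.
move=> finA w [t [v [t0 vw Mv]]].
have [a [f [foo Ma]]] := bigcup_finite_subsequence finA Mv.
exists a => //; exists (t \o f), (v \o f); split=> //.
  exact: decreases_to0_subsequence.
by apply: cvg_comp foo vw.
Qed.

(** The points [x + t_k v_k] witnessing the tangency converge to [x]. *)
Lemma tangent_cone_closure X x u : tangent_cone X x u -> closure X x.
Proof.
move=> [t [v [[_ t0] vu Xv]]].
apply: (@closed_cvg _ _ \oo _ (fun k => x + t k *: v k)).
- exact: closed_closure.
- by apply: nearW => k; exact/subset_closure/Xv.
- rewrite -[X in _ --> X]addr0 -(scale0r u).
  by apply: cvgD; [exact: cvg_cst | exact: cvgZ].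
Qed.

(** [x + t u + t^2 v / 2 = x + t (u + t v / 2)], and [u + t v / 2] tends to [u]
    as [t] tends to 0 and [v] converges. *)
Lemma second_order_tangent_set_tangent X x u w :
  second_order_tangent_set X x u w -> tangent_cone X x u.
Proof.
move=> [t [v [[t_gt0 t0] vw Xv]]].
exists t, (fun k => u + (2^-1 * t k) *: v k); split=> // [|k].
- rewrite -[X in _ --> X]addr0 -(scale0r w) -(mulr0 2^-1).
  by apply: cvgD; [exact: cvg_cst | apply: cvgZ vw; exact: cvgMr].
- by rewrite scalerDr addrA scalerA mulrCA -expr2.
Qed.

(** The arc is sampled at times tending to 0; division of the [o(t^2)] remainder
    by [t^2 / 2] turns it into a null perturbation of [w]. *)
Lemma arc_second_order_tangent_set_sub X x u :
  arc_second_order_tangent_set X x u `<=` second_order_tangent_set X x u.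
Proof.
move=> w [e [gamma [e0 [_ Xgamma _] /eqoP o_rem]]].
pose rem t := gamma t - (x + t *: u + (2^-1 * t ^+ 2) *: w).
(* The factor 1/2 keeps the first sample, at k = 0, strictly below e. *)
pose t k : R := e / 2 * harmonic k.
have t0 : decreases_to0 t.
  by apply: decreases_to0_scaled_harmonic; rewrite divr_gt0.
have t_right : t @ \oo --> (0 : R)^'+.
  move=> B /= [d /= d0 dB]; have /cvgrPdist_lt/(_ _ d0) := t0.2.
  by apply: filterS => k dk; apply: dB => //=; exact: t0.1.
have t_neq0 k : t k ^+ 2 != 0 by rewrite sqrf_eq0 gt_eqF // t0.1.
exists t, (fun k => w + (2 * (t k ^+ 2)^-1) *: rem (t k)); split=> // [|k].
- apply/cvgrPdist_le => eps eps0; near=> k.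
  rewrite opprD addNKr normrN normrZ ger0_norm ?mulr_ge0 ?invr_ge0 ?sqr_ge0 //.
  rewrite mulrAC ler_pdivrMr ?lt_def ?t_neq0 ?sqr_ge0 //.
  rewrite mulrC -ler_pdivlMr // mulrAC -[t k ^+ 2]ger0_norm ?sqr_ge0 //.
  by near: k; apply: (t_right _ (o_rem _ _)); rewrite divr_gt0.
- have tke : t k \in `]0, e[.
    rewrite in_itv /= t0.1 /= /t -mulrA gtr_pMr // /harmonic /=.
    rewrite -invfM invf_lt1 ?mulr_gt0 //.
    by rewrite -natrM ltr1n mulnS.
  move: (Xgamma _ tke); congr X; rewrite scalerDr scalerA mulrACA mulVf ?pnatr_eq0 //.
  by rewrite mul1r mulfV // scale1r addrA /rem addrC subrK.
Unshelve. all: by end_near. Qed.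

End tangent_sets.

Theorem theorem3p8 (R : realType) (n : nat) (A : Type)
    (S : set 'rV[R]_n) (M : A -> set 'rV[R]_n) (xbar u : 'rV[R]_n)
    (clS : closed S) (saS : semialgebraic S)
    (stratS : finite_C2_semialgebraic_stratification S M)
    (Sxbar : S xbar) (TSu : tangent_cone S xbar u) :
  let T2 X := second_order_tangent_set X xbar u in
  let T2arc a := arc_second_order_tangent_set (M a) xbar u in
  let Axu := selected_strata M xbar u in
  [/\ finite_set Axu /\ Axu !=set0,
      T2 S `<=` \bigcup_(a in Axu) T2 (closure (M a)),
      forall a, Axu a -> T2arc a `<=` T2 S,
      (forall a, Axu a -> T2 (closure (M a)) = T2arc a) ->
        T2 S = \bigcup_(a in Axu) T2 (closure (M a)) &
      forall a0, Axu = [set a0] -> T2 (closure (M a0)) = T2arc a0 ->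
        T2 S = T2 (closure (M a0))].
Proof.
move=> T2 T2arc Axu; case: stratS => finA _ _ MS _.
have selected a : tangent_cone (M a) xbar u -> Axu a.
  move=> Mau; split; first exact: tangent_cone_closure Mau.
  by apply: tangent_cone_sub Mau; exact: subset_closure.
have T2S_sub : T2 S `<=` \bigcup_(a in Axu) T2 (closure (M a)).
  rewrite /T2 -MS => w /(second_order_tangent_set_bigcup finA)[a _ Maw].
  exists a; first exact/selected/(second_order_tangent_set_tangent Maw).
  by apply: second_order_tangent_set_sub Maw; exact: subset_closure.
have M_sub a : M a `<=` S by rewrite -MS; exact: bigcup_sup.
have T2arc_sub a : T2arc a `<=` T2 S.
  apply: subset_trans (@arc_second_order_tangent_set_sub _ _ _ _ _) _.
  exact: second_order_tangent_set_sub.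
have T2cl_sub a : T2 (closure (M a)) `<=` T2 S.
  apply: second_order_tangent_set_sub.
  by rewrite [X in _ `<=` X](closure_id S).1 //; exact: closureS.
have T2S_eq : T2 S = \bigcup_(a in Axu) T2 (closure (M a)).
  by apply/seteqP; split=> // w [a _]; exact: T2cl_sub.
split=> //; last by move=> a0 Axu1 _; rewrite T2S_eq Axu1 bigcup_set1.
split; first by apply: sub_finite_set finA.
move: TSu; rewrite -MS => /(tangent_cone_bigcup finA)[a _ Mau].
by exists a; exact: selected.
Qed.
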